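(* Let $E$ be a sharply dominating atomic Archimedean lattice effect algebra, with compatibility center $\mathrm{B}(E)$ and center $\mathrm{C}(E)$. Then the following conditions are equivalent: (i) $\mathrm{B}(E)$ is atomic. (ii) $\mathrm{C}(E)$ is atomic.
   Context: An effect algebra is a partial algebra $(E;\oplus,0,1)$ with $0\ne 1$ and a partially defined binary operation $\oplus$ such that for all $x,y,z\in E$: (Ei) $x\oplus y=y\oplus x$ if $x\oplus y$ is defined; (Eii) $(x\oplus y)\oplus z=x\oplus(y\oplus z)$ if one side is defined; (Eiii) for every $x$ there is a unique $y$ with $x\oplus y=1$ (write $x'=y$); (Eiv) if $1\oplus x$ is defined then $x=0$. Put $x\le y$ and $y\ominus x=z$ iff $x\oplus z$ is defined and equals $y$; $\le$ is a partial order. $E$ is a lattice effect algebra if $(E,\le)$ is a lattice. For $x\in E$, $\mathrm{ord}(x)$ is the greatest positive integer $n$ for which $nx=x\oplus\cdots\oplus x$ ($n$ times) exists, and $\infty$ if all $nx$ exist; $E$ is Archimedean if $\mathrm{ord}(x)<\infty$ for all nonzero $x\in E$. An atom of an effect algebra is a minimal nonzero element; an effect algebra is atomic if below every nonzero element of it there is an atom of it. Sharp elements: $\mathrm{S}(E)=\{x\in E\mid x\wedge x'=0\}$. $E$ is sharply dominating if for every $x\in E$ there is a smallest sharp element $\widehat{x}\in\mathrm{S}(E)$ with $x\le\widehat{x}$. In a lattice effect algebra, $x$ and $y$ are compatible ($x\leftrightarrow y$) if $x\vee y=x\oplus(y\ominus(x\wedge y))$. The compatibility center is $\mathrm{B}(E)=\{x\in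 E\mid x\leftrightarrow y\text{ for every }y\in E\}$. The center is $\mathrm{C}(E)=\{x\in E\mid y=(y\wedge x)\vee(y\wedge x')\text{ for all }y\in E\}$; one has $\mathrm{C}(E)=\mathrm{B}(E)\cap\mathrm{S}(E)$. Both are sub-lattice effect algebras of $E$, hence lattice effect algebras in their own right with inherited operation and order; atomicity of $\mathrm{B}(E)$ and $\mathrm{C}(E)$ is meant with respect to atoms of $\mathrm{B}(E)$ and of $\mathrm{C}(E)$ respectively. *)

(* Defs.v *)
From HB Require Import structures.
From mathcomp Require Import all_boot all_order.
From mathcomp Require Import classical_sets.

Set Implicit Arguments.
Unset Strict Implicit.
Unset Printing Implicit Defensive.

Import Order.TTheory.
Local Open Scope classical_set_scope.

(* The partial operation is total into [option]: [None] means "undefined". An *)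
(* equation between options thus asserts that both sides are undefined, or    *)
(* that both are defined and equal.                                           *)
HB.mixin Record isEffectAlgebra E of Choice E := {
  ezero : E;
  eone : E;
  oplus : E -> E -> option E;
  ezero_neq_eone : ezero <> eone;
  oplusC : forall x y, oplus x y = oplus y x;
  oplusA : forall x y z,
    obind (fun s => oplus s z) (oplus x y) =
    obind (fun t => oplus x t) (oplus y z);
  orth_exists_unique : forall x, exists! y, oplus x y = Some eone;
  oplus_eone : forall x, isSome (oplus eone x) -> x = ezero
}.

#[short(type="effectAlgebraType")]
HB.structure Definition EffectAlgebra := {E of Choice E & isEffectAlgebra E}.

Arguments ezero {s}.
Arguments eone {s}.

Declare Scope effect_scope.
Delimit Scope effect_scope with EA.
Local Open Scope effect_scope.

Notation "0" := ezero : effect_scope.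
Notation "1" := eone : effect_scope.
Notation "x ⊕ y" := (oplus x y) (at level 50, left associativity) : effect_scope.

Section EffectAlgebraDefs.
Variable E : effectAlgebraType.
Implicit Types (x y z : E) (n : nat).

Lemma orth_exists x : exists y, x ⊕ y == Some 1.
Proof. by have [y [/eqP xy _]] := orth_exists_unique x; exists y. Qed.

Definition orth x : E := xchoose (orth_exists x).

(* Graph of the partial difference: [y ⊖ x] is defined and equal to [z]. *)
Definition is_ominus y x z : Prop := x ⊕ z = Some y.

Definition emuln x n : option E := iter n (obind (oplus x)) (Some 0).

(* [ord x] is finite and equal to [n]. *)
Definition is_ord x n : Prop :=
  [/\ (0 < n)%N, isSome (emuln x n)
    & forall m, (0 < m)%N -> isSome (emuln x m) -> (m <= n)%N].

Definition archimedean : Prop := forall x, x <> 0 -> exists n, is_ord x n.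

End EffectAlgebraDefs.

Arguments archimedean : clear implicits.

Notation "x ^⊥" := (orth x) (at level 2, format "x ^⊥") : effect_scope.

(* The lattice order is forced to be the one induced by the partial sum.      *)
(* Having it boolean costs no generality classically.                         *)
HB.mixin Record EffectAlgebra_isLattice d E
    of EffectAlgebra E & Order.Lattice d E := {
  leEoplus : forall x y : E, (x <= y)%O <-> exists z, is_ominus y x z
}.

#[short(type="latticeEffectAlgebraType")]
HB.structure Definition LatticeEffectAlgebra d :=
  {E of EffectAlgebra E & Order.Lattice d E & EffectAlgebra_isLattice d E}.

Section LatticeEffectAlgebraDefs.
Variables (d : Order.disp_t) (E : latticeEffectAlgebraType d).
Implicit Types (x y z a b : E) (A : set E).

Definition sharp : set E := [set x | Order.meet x x^⊥ = 0].

Definition sharply_dominating : Prop :=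
  forall x, exists s, [/\ sharp s, (x <= s)%O
    & forall t, sharp t -> (x <= t)%O -> (s <= t)%O].

(* [x ∨ y = x ⊕ (y ⊖ (x ∧ y))], with [z] the difference. *)
Definition compatible x y : Prop :=
  exists z, is_ominus y (Order.meet x y) z /\ x ⊕ z = Some (Order.join x y).

Definition compatibility_center : set E := [set x | forall y, compatible x y].

Definition center : set E :=
  [set x | forall y, y = Order.join (Order.meet y x) (Order.meet y x^⊥)].

(* Atoms and atomicity of a sub-effect algebra [A] under the inherited order: *)
(* an atom of [A] need not be an atom of [E].                                 *)
Definition atom_of A a : Prop :=
  [/\ A a, a <> 0 & forall b, A b -> b <> 0 -> (b <= a)%O -> b = a].

Definition atomic A : Prop :=
  forall x, A x -> x <> 0 -> exists a, atom_of A a /\ (a <= x)%O.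

End LatticeEffectAlgebraDefs.

Arguments sharp {d} E.
Arguments sharply_dominating {d} E.
Arguments compatibility_center {d} E.
Arguments center {d} E.

(* Main.v *)
Require Import Defs.
From HB Require Import structures.
From mathcomp Require Import all_boot all_order.
From mathcomp Require Import classical_sets.
From mathcomp Require Import boolp.

(** Write B for the compatibility center and C for the center, and call the
    smallest sharp element above x the cover of x.  Everything rests on the
    fact that the cover s of x is central as soon as x lies in B
    ([sharp_cover_central]).  Indeed, let a be an atom of E.  Either
    a <= x <= s, or a meets x trivially; in the second case x, being compatible
    with everything, lies below the orthosupplement of n a, where n = ord a
    ([compatibility_center_le_orth_ord]).  Since n a is sharp
    ([sharp_emuln_ord]), s lies below the same orthosupplement, so that
    a <= n a <= s^⊥.  Hence each atom is below s or below s^⊥; in an atomic E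
    this forces the sharp element s to be central ([center_of_atoms]), because
    sharp elements are principal ([sharp_principal]).

    If B is atomic and x <> 0 is central, take an atom p of B below x.  The
    cover of p is central, lies below x, and is an atom of C: a central c below
    it cuts out of p an element of B ([compatibility_center_meet]), which can
    only be 0 or p.

    If C is atomic and x <> 0 lies in B, choose an atom c of C below the cover
    of x.  Then x /\ c is a nonzero element of B.  Every nonzero y in B below c
    has cover c, hence lies above each atom b <= c of E
    ([atom_le_of_center_atom]).  Were there no atom of B below x /\ c, one
    could split x /\ c into arbitrarily many nonzero summands from B, each
    above b, so that every multiple of b would exist
    ([emuln_le_of_atomless]), against the Archimedean property. *)

Section LatticeEffectAlgebraTheory.
Set Implicit Arguments.
Unset Strict Implicit.

Variables (d : Order.disp_t) (E : latticeEffectAlgebraType d).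
Implicit Types (x y z s t u v w a b c : E).

Import Order.TTheory.
Local Open Scope classical_set_scope.
Local Open Scope order_scope.
Local Open Scope effect_scope.

(** * Partial sums and the induced order *)

Lemma oplus_assocr x y z s w : x ⊕ y = Some s -> s ⊕ z = Some w ->
  exists2 t, y ⊕ z = Some t & x ⊕ t = Some w.
Proof.
move=> xy sz; have := oplusA x y z; rewrite xy /= sz.
by case: (y ⊕ z) => [t|//] /= xt; exists t.
Qed.

Lemma oplus_orth x : x ⊕ x^⊥ = Some 1.
Proof. exact/eqP/(xchooseP (orth_exists x)). Qed.

Lemma orth_unique x y : x ⊕ y = Some 1 -> y = x^⊥.
Proof.
move=> xy; have [z [_ uz]] := orth_exists_unique x.
by rewrite -(uz y xy) -(uz x^⊥ (oplus_orth x)).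
Qed.

Lemma orthK x : x^⊥^⊥ = x.
Proof. by apply/esym/orth_unique; rewrite oplusC oplus_orth. Qed.

Lemma oplus0 x : x ⊕ 0 = Some x.
Proof.
have one0 : (1 : E) ⊕ 0 = Some 1.
  have one' : (1 : E)^⊥ = 0 by apply: oplus_eone; rewrite oplus_orth.
  by rewrite -[in LHS]one' oplus_orth.
have x'x : x^⊥ ⊕ x = Some 1 by rewrite oplusC oplus_orth.
have [t -> /orth_unique ->] := oplus_assocr x'x one0.
by rewrite orthK.
Qed.

Lemma oplus_cancel x y z w : x ⊕ y = Some w -> x ⊕ z = Some w -> y = z.
Proof.
move=> xy xz; have ww' := oplus_orth w.
have [t xw' yt] : exists2 t, x ⊕ w^⊥ = Some t & y ⊕ t = Some 1.
  by apply: oplus_assocr ww'; rewrite oplusC.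
have [t1 xw'1 zt1] : exists2 t, x ⊕ w^⊥ = Some t & z ⊕ t = Some 1.
  by apply: oplus_assocr ww'; rewrite oplusC.
move: xw'1; rewrite xw' => -[?]; subst t1.
by move: yt zt1; rewrite ![_ ⊕ t]oplusC => /orth_unique -> /orth_unique ->.
Qed.

Lemma oplus_lel x y w : x ⊕ y = Some w -> x <= w.
Proof. by move=> xy; apply/leEoplus; exists y. Qed.

Lemma oplus_ler x y w : x ⊕ y = Some w -> y <= w.
Proof. by rewrite oplusC => /oplus_lel. Qed.

Lemma le_ominus x y : x <= y -> exists z, x ⊕ z = Some y.
Proof. by move/leEoplus. Qed.

Lemma le0e x : 0 <= x.
Proof. by apply: (@oplus_ler x); rewrite oplus0. Qed.

Lemma lee0 x : x <= 0 -> x = 0.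
Proof. by move=> x0; apply: le_anti; rewrite x0 le0e. Qed.

Lemma oplus_monol x x1 y w : x1 <= x -> x ⊕ y = Some w ->
  exists2 w1, x1 ⊕ y = Some w1 & w1 <= w.
Proof.
move=> /le_ominus[e]; rewrite oplusC => ex1 xy.
have [t x1y /oplus_ler tw] := oplus_assocr ex1 xy.
by exists t.
Qed.

Lemma oplus_monor x y y1 w : y1 <= y -> x ⊕ y = Some w ->
  exists2 w1, x ⊕ y1 = Some w1 & w1 <= w.
Proof. by move=> yy1; rewrite ![x ⊕ _]oplusC; apply: oplus_monol. Qed.

Lemma oplus_mono x x1 y y1 w : x1 <= x -> y1 <= y -> x ⊕ y = Some w ->
  exists2 w1, x1 ⊕ y1 = Some w1 & w1 <= w.
Proof.
move=> xx1 yy1 /(oplus_monol xx1)[t x1y tw].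
have [w1 ? w1t] := oplus_monor yy1 x1y.
by exists w1 => //; apply: le_trans tw.
Qed.

Lemma oplus_le_cancel x y z v w :
  x ⊕ y = Some v -> x ⊕ z = Some w -> v <= w -> y <= z.
Proof.
move=> xy xz /le_ominus[e ve].
have [t yt xt] := oplus_assocr xy ve.
by rewrite -(oplus_cancel xt xz); apply: oplus_lel yt.
Qed.

Lemma oplus_le_orth x y w : x ⊕ y = Some w -> y <= x^⊥.
Proof.
move=> xy; have [t yt /orth_unique <-] :=
  oplus_assocr xy (oplus_orth w).
exact: oplus_lel yt.
Qed.

Lemma le_orth_oplus x y : y <= x^⊥ -> exists w, x ⊕ y = Some w.
Proof.
by move=> /oplus_monor/(_ (oplus_orth x))[w xy _]; exists w.
Qed.

Lemma le_orthC x y : y <= x^⊥ -> x <= y^⊥.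
Proof. by case/le_orth_oplus=> w; rewrite oplusC => /oplus_le_orth. Qed.

(** * Compatibility *)

(** Compatibility asks for a decomposition of y over x /\ y; any common lower
    bound w with complement v in y orthogonal to x will do, because replacing w
    by x /\ y only shrinks v. *)
Lemma compatible_of_decomposition x y w v p :
  w <= x -> w ⊕ v = Some y -> x ⊕ v = Some p -> compatible x y.
Proof.
move=> wx wv xv; set m := Order.meet x y.
have wm : w <= m by rewrite lexI wx (oplus_lel wv).
have /le_ominus[v1 mv1] : m <= y by rewrite leIr.
have /le_ominus[u mu] : m <= x by rewrite leIl.
have /le_ominus[e we] := wm.
have [t /oplus_ler v1t wt] := oplus_assocr we mv1.
have v1v : v1 <= v by rewrite -(oplus_cancel wt wv).
have [q xv1 _] := oplus_monor v1v xv.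
have um : u ⊕ m = Some x by rewrite oplusC.
have [y1] := oplus_assocr um xv1.
rewrite mv1 oplusC => -[<-] yu.
have jq : Order.join x y <= q.
  by rewrite leUx (oplus_lel xv1) (oplus_lel yu).
have /le_ominus[r jr] := jq.
have [q1 xr q1q] := oplus_monol (leUl x y) jr.
have [q2 yr q2q] := oplus_monol (leUr y x) jr.
have rv1 := oplus_le_cancel xr xv1 q1q.
have ru := oplus_le_cancel yr yu q2q.
have [k mr kx] := oplus_monor ru mu.
have [k1] := oplus_monor rv1 mv1; rewrite mr => -[<-] ky.
have r0 : r = 0.
  apply: lee0; apply: (@oplus_le_cancel m _ _ k m) => //; first exact: oplus0.
  by rewrite lexI kx ky.
move: jr; rewrite r0 oplus0 => -[jq'].
by exists v1; split=> //; rewrite jq'.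
Qed.

Lemma oplus_disjoint x y w :
  x ⊕ y = Some w -> Order.meet x y = 0 -> w = Order.join x y.
Proof.
move=> xy xy0; have y0 : 0 ⊕ y = Some y by rewrite oplusC oplus0.
have [z []] := compatible_of_decomposition (le0e x) y0 xy.
by rewrite /is_ominus xy0 oplusC oplus0 => -[->]; rewrite xy => -[->].
Qed.

Lemma compatible_disjoint_oplus x y :
  compatible x y -> Order.meet x y = 0 -> exists w, x ⊕ y = Some w.
Proof.
move=> [z [yz xz]] xy0; move: yz; rewrite /is_ominus xy0 oplusC oplus0.
by move=> [<-]; exists (Order.join x y).
Qed.

(** * Sharp elements *)

Lemma sharp_orth s : sharp E s -> sharp E s^⊥.
Proof. by rewrite /sharp /= orthK meetC. Qed.

Lemma sharp_le_orth_eq0 x : sharp E x -> x <= x^⊥ -> x = 0.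
Proof. by move=> sx xx; apply: lee0; rewrite -sx lexI lexx. Qed.

(** The excess r of u + (v \/ (s - u)) over s is at once below s and orthogonal
    to s, so sharpness kills it. *)
Lemma sharp_principal s u v w :
  sharp E s -> u <= s -> v <= s -> u ⊕ v = Some w -> w <= s.
Proof.
move=> ss /le_ominus[e ue] vs uv.
have es := oplus_ler ue.
pose j := Order.join v e.
have js : j <= s by rewrite leUx vs es.
have [k uj] : exists k, u ⊕ j = Some k.
  by apply: le_orth_oplus; rewrite leUx (oplus_le_orth uv)
    (oplus_le_orth ue).
have [k1] := oplus_monor (leUl v e : v <= j) uj.
rewrite uv => -[<-] wk.
have [k2] := oplus_monor (leUr e v : e <= j) uj.
rewrite ue => -[<-] /le_ominus[r sr].
have [j1 /oplus_ler rj1 uj1] := oplus_assocr ue sr.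
have r0 : r = 0.
  apply: lee0; rewrite -ss lexI (oplus_le_orth sr) andbT.
  by apply: le_trans js; rewrite -(oplus_cancel uj1 uj).
by move: sr; rewrite r0 oplus0 => -[->].
Qed.

Lemma emulnS a n : emuln a n.+1 = obind (oplus a) (emuln a n).
Proof. by []. Qed.

(** If t + a exists with t /\ a = 0 then t + a = t \/ a, which stays below k a
    whenever t does; cancelling a lowers k by one. *)
Lemma disjoint_emuln_eq0 t a k p q : emuln a k = Some p -> t <= p ->
  t ⊕ a = Some q -> Order.meet t a = 0 -> t = 0.
Proof.
move=> + + ta ta0; elim: k p => [|k IHk] p.
  by move=> [<-] /lee0.
rewrite emulnS; case ak: (emuln a k) => [p1|//] /= ap1 tp.
apply: (IHk p1) => //; have at_ : a ⊕ t = Some q by rewrite oplusC.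
apply: (oplus_le_cancel at_ ap1).
by rewrite (oplus_disjoint ta ta0) leUx tp (oplus_lel ap1).
Qed.

(** * Atoms *)

Lemma atom_le_or_disjoint a x :
  atom_of setT a -> a <= x \/ Order.meet x a = 0.
Proof.
move=> [_ _ amin]; case: (eqVneq (Order.meet x a) 0) => [|/eqP xa].
  by right.
by left; rewrite -(amin (Order.meet x a)) // ?leIl ?leIr.
Qed.

Lemma emuln_ord_ge a n p : is_ord a n -> emuln a n = Some p -> a <= p.
Proof.
case: n => [[]//|n] _; rewrite emulnS; case: (emuln a n) => [p1|//] /=.
exact: oplus_lel.
Qed.

(** Maximality of n keeps the atom a from lying below p^⊥, so a meets p^⊥, and
    with it p /\ p^⊥, trivially; but then nothing nonzero below both the
    multiple p of a and p^⊥ is left. *)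
Lemma sharp_emuln_ord a n p :
  atom_of setT a -> is_ord a n -> emuln a n = Some p -> sharp E p.
Proof.
move=> a_atom a_ord anp.
have ap : Order.meet p^⊥ a = 0.
  case: (atom_le_or_disjoint p^⊥ a_atom) => // /le_orth_oplus[w].
  rewrite oplusC => pa; case: a_ord => n_gt0 _ /(_ n.+1 isT).
  by rewrite emulnS anp /= pa ltnn => /(_ isT).
rewrite /sharp /=; set t := Order.meet p p^⊥.
have /le_orth_oplus[q] : t <= a^⊥.
  apply: le_orthC; apply: le_trans (emuln_ord_ge a_ord anp) _.
  by apply: le_orthC; rewrite leIr.
rewrite oplusC => ta; apply: (disjoint_emuln_eq0 anp _ ta).
  by rewrite leIl.
by apply: lee0; rewrite -ap leI2 // leIr.
Qed.

(** * The compatibility center *)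

Local Notation B := (compatibility_center E).
Local Notation C := (center E).

(** A difference x - y of elements of B is compatible with z: splitting z along
    x, and x /\ z along y, exhibits the part of z below x - y and leaves a
    remainder orthogonal to it. *)
Lemma compatibility_center_ominus x y e : B x -> B y -> y ⊕ e = Some x -> B e.
Proof.
move=> Bx By ye z.
have [z1 [mz1 xz1]] := Bx z; rewrite /is_ominus in mz1.
have [r [qr yr]] := By (Order.meet x z); rewrite /is_ominus in qr.
have re : r <= e.
  apply: (oplus_le_cancel yr ye).
  by rewrite leUx (oplus_lel ye) leIl.
have rq : r ⊕ Order.meet y (Order.meet x z) = Some (Order.meet x z).
  by rewrite oplusC.
have [v qz1 rv] := oplus_assocr rq mz1.
have ey : e ⊕ y = Some x by rewrite oplusC.
have [v1 yz1 ev1] := oplus_assocr ey xz1.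
have [v2] := oplus_monol (leIl y (Order.meet x z)) yz1.
rewrite qz1 => -[<-] vv1.
have [p ev _] := oplus_monor vv1 ev1.
exact: compatible_of_decomposition re rv ev.
Qed.

(** Compatible disjoint elements are orthogonal; disjointness from b passes to
    the multiple p of b, with which x is compatible as well. *)
Lemma compatibility_center_le_orth_ord x b n p :
  is_ord b n -> emuln b n = Some p -> B x -> Order.meet x b = 0 -> x <= p^⊥.
Proof.
move=> b_ord bnp Bx xb0.
have [q xb] := compatible_disjoint_oplus (Bx b) xb0.
have xp0 : Order.meet x p = 0.
  have [q1 tb _] := oplus_monol (leIl x p) xb.
  apply: (disjoint_emuln_eq0 bnp _ tb); first by rewrite leIr.
  by apply: lee0; rewrite -xb0 leI2 // leIl.
have [w] := compatible_disjoint_oplus (Bx p) xp0.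
by rewrite oplusC => /oplus_le_orth.
Qed.

(** * The center *)

Lemma center_sharp c : C c -> sharp E c.
Proof.
move=> Cc; rewrite /sharp /=; set m := Order.meet c c^⊥.
have le1 x : x <= 1 by apply: oplus_lel (oplus_orth x).
have one : Order.join c c^⊥ = 1.
  by rewrite [RHS](Cc 1) !(meet_r (le1 _)).
have : 1 <= m^⊥.
  rewrite -one leUx; apply/andP; split; apply: le_orthC.
    by rewrite leIr.
  by rewrite orthK leIl.
by move=> /le_orthC/le_orth_oplus[w m1]; apply: oplus_eone; rewrite m1.
Qed.

Lemma center_split c y : C c ->
  Order.meet y c ⊕ Order.meet y c^⊥ = Some y.
Proof.
move=> Cc; have [w yw] : exists w, Order.meet y c ⊕ Order.meet y c^⊥ = Some w.
  apply: le_orth_oplus; apply: le_orthC.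
  apply: (@le_trans _ _ c); first by rewrite leIr.
  by apply: le_orthC; rewrite leIr.
rewrite yw (oplus_disjoint yw) -?(Cc y) //.
apply: lee0; rewrite -(center_sharp Cc).
by rewrite leI2 // leIr.
Qed.

Lemma center_sub_compatibility_center c : C c -> B c.
Proof.
move=> Cc y; have [w cw] : exists w, c ⊕ Order.meet y c^⊥ = Some w.
  by apply: le_orth_oplus; rewrite leIr.
exact: compatible_of_decomposition (leIr c y) (center_split y Cc) cw.
Qed.

Lemma center_disjoint_le_orth c x : C c -> Order.meet x c = 0 -> x <= c^⊥.
Proof.
move=> Cc xc0; have := center_split x Cc.
by rewrite xc0 oplusC oplus0 => -[<-]; rewrite leIr.
Qed.

(** Only the part of z below c interacts with x /\ c; there the decomposition
    for x and z /\ c can be reused, and it stays below c since c is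
    principal. *)
Lemma compatibility_center_meet c x : C c -> B x -> B (Order.meet x c).
Proof.
move=> Cc Bx z; pose z1 := Order.meet z c.
have [v [wv xv]] := Bx z1; rewrite /is_ominus in wv.
have vc : v <= c.
  by apply: le_trans (oplus_ler wv) _; rewrite leIr.
have [p x1v _] := oplus_monol (leIl x c) xv.
have pc : p <= c.
  by apply: sharp_principal x1v; rewrite ?leIr //; apply: center_sharp.
have [t vz2 wt] := oplus_assocr wv (center_split z Cc).
have [q pz2] : exists q, p ⊕ Order.meet z c^⊥ = Some q.
  apply: le_orth_oplus; apply: le_orthC; apply: le_trans pc _.
  by apply: le_orthC; rewrite leIr.
have [t1] := oplus_assocr x1v pz2; rewrite vz2 => -[<-] x1t.
apply: compatible_of_decomposition wt x1t.
by rewrite leI2 // leIr.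
Qed.

Hypothesis E_atomic : atomic [set: E].

(** If z = (y /\ s) \/ (y /\ s^⊥) were not y, an atom a below y - z would lie
    below s, say; it could be added to y /\ s without leaving y (there is room
    above z) nor s (which is principal), so a would be 0. *)
Lemma center_of_atoms s : sharp E s ->
  (forall a, atom_of setT a -> a <= s \/ a <= s^⊥) -> C s.
Proof.
move=> ss s_atoms y.
set z := Order.join (Order.meet y s) (Order.meet y s^⊥).
have /le_ominus[e ze] : z <= y by rewrite leUx !leIl.
have absorb s1 a : sharp E s1 -> Order.meet y s1 <= z -> a <= e -> a <= s1 ->
    a = 0.
  move=> ss1 mz ae as1; have [q mq qy] := oplus_mono mz ae ze.
  apply: lee0; apply: (oplus_le_cancel mq (oplus0 _)).
  by rewrite lexI qy; apply: sharp_principal mq; rewrite ?leIr.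
case: (eqVneq e 0) => [e0|/eqP e0].
  by move: ze; rewrite e0 oplus0 => -[].
have [a [a_atom ae]] := E_atomic I e0.
have [_ a0 _] := a_atom; case: a0.
case: (s_atoms a a_atom) => [as1|as1]; apply: (absorb _ _ _ _ ae as1) => //.
- exact: leUl.
- exact: sharp_orth.
- exact: leUr.
Qed.

(** * Covers of elements of the compatibility center *)

Hypothesis E_archimedean : archimedean E.

Lemma atom_ord a : atom_of setT a ->
  exists n p, is_ord a n /\ emuln a n = Some p.
Proof.
move=> [_ a0 _]; have [n a_ord] := E_archimedean a0.
by have [_] := a_ord; case anp: (emuln a n) => [p|//] _ _; exists n, p.
Qed.

(** The orthosupplement of (ord b) b is sharp and lies above x, hence above the
    cover s; as b <= (ord b) b, this pushes b below s^⊥. *)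
Lemma sharp_cover_le_orth x s b : B x ->
  (forall t, sharp E t -> x <= t -> s <= t) ->
  atom_of setT b -> Order.meet x b = 0 -> b <= s^⊥.
Proof.
move=> Bx s_min b_atom xb0; have [n [p [b_ord bnp]]] := atom_ord b_atom.
apply: le_trans (emuln_ord_ge b_ord bnp) _; apply: le_orthC.
apply: s_min; first by apply: sharp_orth; apply: sharp_emuln_ord bnp.
exact: compatibility_center_le_orth_ord bnp Bx xb0.
Qed.

Lemma sharp_cover_central x s : B x -> sharp E s -> x <= s ->
  (forall t, sharp E t -> x <= t -> s <= t) -> C s.
Proof.
move=> Bx ss xs s_min; apply: center_of_atoms => // a a_atom.
case: (atom_le_or_disjoint x a_atom) => [ax|xa0].
  by left; apply: le_trans xs.
by right; apply: sharp_cover_le_orth xa0.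
Qed.

Hypothesis E_sharply_dominating : sharply_dominating E.

Lemma central_cover x : B x -> exists s, [/\ C s, x <= s
  & forall t, sharp E t -> x <= t -> s <= t].
Proof.
move=> Bx; have [s [ss xs s_min]] := E_sharply_dominating x.
by exists s; split=> //; apply: sharp_cover_central xs s_min.
Qed.

(** * Transfer of atomicity *)

Lemma atomic_center_of_atomic_compatibility_center : atomic B -> atomic C.
Proof.
move=> B_atomic x Cx x0.
have [p [[Bp p0 p_min] px]] :=
  B_atomic x (center_sub_compatibility_center Cx) x0.
have [s [Cs ps s_min]] := central_cover Bp.
exists s; split; last by apply: s_min => //; apply: center_sharp.
split=> //; first by move=> s0; apply: p0; apply: lee0; rewrite -s0.
move=> c Cc c0 cs.
case: (eqVneq (Order.meet p c) 0) => [pc0|/eqP pc].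
  case: c0; apply: sharp_le_orth_eq0; first exact: center_sharp.
  apply: le_trans cs _; apply: s_min.
    by apply/sharp_orth/center_sharp.
  exact: center_disjoint_le_orth.
apply: le_anti; rewrite cs; apply: s_min; first exact: center_sharp.
have <- : Order.meet p c = p.
  by apply: p_min => //; [apply: compatibility_center_meet | rewrite leIl].
by rewrite leIr.
Qed.

(** The cover of y is central and below c, so it is c itself; were b not below
    y, it would be orthogonal to that cover. *)
Lemma atom_le_of_center_atom c b y : atom_of C c ->
  atom_of setT b -> b <= c -> B y -> y <> 0 -> y <= c -> b <= y.
Proof.
move=> [Cc c0 c_min] b_atom bc By y0 yc.
have [s [Cs ys s_min]] := central_cover By.
have sc : s = c.
  apply: c_min => //; first by move=> s0; apply: y0; apply: lee0; rewrite -s0.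
  by apply: s_min => //; apply: center_sharp.
case: (atom_le_or_disjoint y b_atom) => // yb0.
have [_ b0 _] := b_atom; case: b0.
apply: lee0; rewrite -(center_sharp Cc) lexI bc /= -sc.
exact: sharp_cover_le_orth yb0.
Qed.

(** As x is not an atom of B, it splits as y + e with y and e nonzero in B; e
    contributes one copy of b, and y, again with no atom of B below it, the
    others. *)
Lemma emuln_le_of_atomless c b n x : atom_of C c ->
  atom_of setT b -> b <= c -> B x -> x <> 0 -> x <= c ->
  ~ (exists y, atom_of B y /\ y <= x) -> exists2 w, emuln b n = Some w & w <= x.
Proof.
move=> c_atom b_atom bc; elim: n x => [|n IHn] x Bx x0 xc x_atomless.
  by exists 0 => //; apply: le0e.
have [y [By y0 yx yNx]] : exists y, [/\ B y, y <> 0, y <= x & y <> x].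
  apply: contrapT => no_y; apply: x_atomless; exists x; split=> //; split=> //.
  by move=> y By y0 yx; apply: contrapT => yNx; apply: no_y; exists y.
have /le_ominus[e ye] := yx.
have ey : e ⊕ y = Some x by rewrite oplusC.
have be : b <= e.
  apply: (atom_le_of_center_atom c_atom) => //.
  - exact: compatibility_center_ominus ye.
  - by move=> e0; apply: yNx; move: ye; rewrite e0 oplus0 => -[].
  - exact: le_trans (oplus_lel ey) xc.
have [w bw wy] : exists2 w, emuln b n = Some w & w <= y.
  apply: IHn => //; first exact: le_trans xc.
  by move=> [a [a_atom ay]]; apply: x_atomless; exists a; split=> //;
    apply: le_trans yx.
have [w1 bw1 w1x] := oplus_mono be wy ey.
by exists w1 => //; rewrite emulnS bw.
Qed.

Lemma atomic_compatibility_center_of_atomic_center : atomic C -> atomic B.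
Proof.
move=> C_atomic x Bx x0.
have [s [Cs xs s_min]] := central_cover Bx.
have s0 : s <> 0 by move=> s0; apply: x0; apply: lee0; rewrite -s0.
have [c [c_atom cs]] := C_atomic s Cs s0; have [Cc c0 _] := c_atom.
have xc0 : Order.meet x c <> 0.
  move=> xc0; apply: c0; apply: sharp_le_orth_eq0; first exact: center_sharp.
  apply: le_trans cs _; apply: s_min.
    by apply/sharp_orth/center_sharp.
  exact: center_disjoint_le_orth.
apply: contrapT => x_atomless.
have [b [b_atom bc]] := E_atomic I c0.
have [n [p [[_ _ n_max] _]]] := atom_ord b_atom.
have Bxc := compatibility_center_meet Cc Bx.
have [|w bw _] :=
  emuln_le_of_atomless n.+1 c_atom b_atom bc Bxc xc0 (leIr c x).
  move=> [a [a_atom axc]]; apply: x_atomless; exists a; split=> //.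
  by apply: le_trans axc _; rewrite leIl.
by have := n_max n.+1 isT; rewrite bw ltnn => /(_ isT).
Qed.

End LatticeEffectAlgebraTheory.

Theorem theorem2p19 (d : Order.disp_t) (E : latticeEffectAlgebraType d)
    (E_sharply_dominating : sharply_dominating E)
    (E_atomic : atomic [set: E]%classic)
    (E_archimedean : archimedean E) :
  atomic (compatibility_center E) <-> atomic (center E).
Proof.
split; [exact: atomic_center_of_atomic_compatibility_center
       |exact: atomic_compatibility_center_of_atomic_center].
Qed.
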